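(* Every W-normal proof of a sequent in $\mathcal{G}$ can be reduced to a maximalized W-normal proof of the same sequent whose degree is the same as or lower than the degree of the original proof.
   Context: Formulae are built from propositional variables and $\bot$ with the binary connectives $\wedge,\vee,\rightarrow$. Sequents have the form $\Gamma \vdash C$, $\Gamma$ a finite (possibly empty) sequence of formulae, $C$ a formula. The system $\mathcal{G}$ has axioms $A \vdash A$ and $\bot \vdash A$ and rules: (C) from $\Delta, A, B, \Gamma \vdash C$ infer $\Delta, B, A, \Gamma \vdash C$; (W) from $\Theta, A, A, \Gamma \vdash C$ infer $\Theta, A, \Gamma \vdash C$; (K) from $\Theta, \Gamma \vdash C$ infer $\Theta, A, \Gamma \vdash C$; (cut) from $\Delta \vdash A$ and $\Theta, A, \Gamma \vdash C$ infer $\Theta, \Delta, \Gamma \vdash C$ ($A$ is the cut formula); ($\wedge$L) from $\Theta, A, \Gamma \vdash C$ (resp. $\Theta, B, \Gamma \vdash C$) infer $\Theta, A\wedge B, \Gamma \vdash C$; ($\wedge$R) from $\Gamma \vdash A$ and $\Gamma \vdash B$ infer $\Gamma \vdash A \wedge B$; ($\vee$L) from $\Theta, A, \Gamma \vdash C$ and $\Theta, B, \Gamma \vdash C$ infer $\Theta, A \vee B, \Gamma \vdash C$; ($\vee$R) from $\Gamma \vdash A$ (resp. $\Gamma \vdash B$) infer $\Gamma \vdash A \vee B$; ($\rightarrow$L) from $\Delta \vdash A$ and $\Theta, B, \Gamma \vdash C$ infer $\Theta, \Delta, A \rightarrow B, \Gamma \vdash C$; ($\rightarrow$R) from $A, \Gamma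 \vdash B$ infer $\Gamma \vdash A \rightarrow B$. The degree of a cut is the number of binary connectives in its cut formula; the degree of a proof is the maximal degree of its cuts (0 if none). A proof is W-normal iff every application of (W) in it either is the last rule of the proof, or has only applications of (W) below it, or is the upper rule in one of the two contexts: (i) $\Theta, A, A, A, \Gamma \vdash C$ by (W) to $\Theta, A, A, \Gamma \vdash C$ followed by (W) to $\Theta, A, \Gamma \vdash C$; (ii) $A, A, \Gamma \vdash B$ by (W) to $A, \Gamma \vdash B$ followed by ($\rightarrow$R) to $\Gamma \vdash A \rightarrow B$. A cut has rank 2 iff the occurrence of the cut formula in each premise is newly introduced by the last inference of the subproof ending in that premise (i.e., in the left premise it is the succedent of an axiom or the principal formula of a right rule ($\wedge$R), ($\vee$R), ($\rightarrow$R); in the right premise it is a formula of an axiom, the formula added by (K), or the principal formula of a left rule ($\wedge$L), ($\vee$L), ($\rightarrow$L)). A cut is maximal iff it has rank 2 and neither of its premises is an axiom. A proof is maximalized iff all cuts in it are maximal. *)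

(* Defs.v *)
From Stdlib Require Import List PeanoNat.
Import ListNotations.

Inductive formula : Type :=
| Var (n : nat)
| Bot
| And (A B : formula)
| Or (A B : formula)
| Imp (A B : formula).

Fixpoint connectives (A : formula) : nat :=
  match A with
  | Var _ | Bot => 0
  | And A B | Or A B | Imp A B => S (connectives A + connectives B)
  end.

Record sequent : Type := Sequent { antecedent : list formula; succedent : formula }.

Notation "Γ ⊢ C" := (Sequent Γ C) (at level 70, no associativity).

(* [Type]-valued: degree, W-normality and maximality are properties of the
   proof tree itself, and every node records at which occurrence its rule acts. *)
Inductive proof : sequent -> Type :=
| Ax A : proof ([A] ⊢ A)
| BotAx A : proof ([Bot] ⊢ A)
| RuleC Δ A B Γ C :
    proof (Δ ++ A :: B :: Γ ⊢ C) -> proof (Δ ++ B :: A :: Γ ⊢ C)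
| RuleW Θ A Γ C :
    proof (Θ ++ A :: A :: Γ ⊢ C) -> proof (Θ ++ A :: Γ ⊢ C)
| RuleK Θ A Γ C :
    proof (Θ ++ Γ ⊢ C) -> proof (Θ ++ A :: Γ ⊢ C)
| Cut Δ A Θ Γ C :
    proof (Δ ⊢ A) -> proof (Θ ++ A :: Γ ⊢ C) -> proof (Θ ++ Δ ++ Γ ⊢ C)
| AndL1 Θ A B Γ C :
    proof (Θ ++ A :: Γ ⊢ C) -> proof (Θ ++ And A B :: Γ ⊢ C)
| AndL2 Θ A B Γ C :
    proof (Θ ++ B :: Γ ⊢ C) -> proof (Θ ++ And A B :: Γ ⊢ C)
| AndR Γ A B :
    proof (Γ ⊢ A) -> proof (Γ ⊢ B) -> proof (Γ ⊢ And A B)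
| OrL Θ A B Γ C :
    proof (Θ ++ A :: Γ ⊢ C) -> proof (Θ ++ B :: Γ ⊢ C) ->
    proof (Θ ++ Or A B :: Γ ⊢ C)
| OrR1 Γ A B : proof (Γ ⊢ A) -> proof (Γ ⊢ Or A B)
| OrR2 Γ A B : proof (Γ ⊢ B) -> proof (Γ ⊢ Or A B)
| ImpL Δ A B Θ Γ C :
    proof (Δ ⊢ A) -> proof (Θ ++ B :: Γ ⊢ C) ->
    proof (Θ ++ Δ ++ Imp A B :: Γ ⊢ C)
| ImpR A Γ B : proof (A :: Γ ⊢ B) -> proof (Γ ⊢ Imp A B).

(* The degree of a cut is [connectives] of its cut formula. *)
Fixpoint degree {s} (d : proof s) : nat :=
  match d with
  | Ax _ | BotAx _ => 0
  | RuleC _ _ _ _ _ e | RuleW _ _ _ _ e | RuleK _ _ _ _ e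
  | AndL1 _ _ _ _ _ e | AndL2 _ _ _ _ _ e
  | OrR1 _ _ _ e | OrR2 _ _ _ e | ImpR _ _ _ e => degree e
  | Cut _ A _ _ _ e f => Nat.max (connectives A) (Nat.max (degree e) (degree f))
  | AndR _ _ _ e f | OrL _ _ _ _ _ e f | ImpL _ _ _ _ _ _ e f =>
      Nat.max (degree e) (degree f)
  end.

(* Only applications of (W) and of (→R) have to be told apart, together with
   the instance of the schema; all other rules are lumped together. *)
Inductive inference : Type :=
| InfW (Θ : list formula) (A : formula) (Γ : list formula) (C : formula)
| InfImpR (A : formula) (Γ : list formula) (B : formula)
| InfOther.

Definition last_inference {s} (d : proof s) : inference :=
  match d with
  | RuleW Θ A Γ C _ => InfW Θ A Γ C
  | ImpR A Γ B _ => InfImpR A Γ B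
  | _ => InfOther
  end.

(* All inference occurrences of [d], each paired with the list of the
   inferences below it, nearest first; [below] is what lies below [d]. *)
Fixpoint occurrences (below : list inference) {s} (d : proof s)
  : list (inference * list inference) :=
  let below' := last_inference d :: below in
  (last_inference d, below) ::
  match d with
  | Ax _ | BotAx _ => []
  | RuleC _ _ _ _ _ e | RuleW _ _ _ _ e | RuleK _ _ _ _ e
  | AndL1 _ _ _ _ _ e | AndL2 _ _ _ _ _ e
  | OrR1 _ _ _ e | OrR2 _ _ _ e | ImpR _ _ _ e => occurrences below' e
  | Cut _ _ _ _ _ e f | AndR _ _ _ e f | OrL _ _ _ _ _ e f
  | ImpL _ _ _ _ _ _ e f => occurrences below' e ++ occurrences below' f
  end.

Definition is_W (i : inference) : Prop :=
  match i with InfW _ _ _ _ => True | _ => False end.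

(* [W_context u l]: the upper inference [u], immediately followed by [l], is in
   context (i) or (ii).  In Θ, A, A, A, Γ ⊢ C the upper (W) of (i) may contract
   the first two or the last two displayed occurrences of A. *)
Inductive W_context : inference -> inference -> Prop :=
| W_context_i_first Θ A Γ C : W_context (InfW Θ A (A :: Γ) C) (InfW Θ A Γ C)
| W_context_i_last Θ A Γ C : W_context (InfW (Θ ++ [A]) A Γ C) (InfW Θ A Γ C)
| W_context_ii A Γ B : W_context (InfW [] A Γ B) (InfImpR A Γ B).

(* [Forall is_W []] is the case of a (W) that is the last rule of the proof. *)
Definition W_normal {s} (d : proof s) : Prop :=
  forall u below, In (u, below) (occurrences [] d) -> is_W u ->
    Forall is_W below \/
    exists l below', below = l :: below' /\ W_context u l.

Definition is_axiom {s} (d : proof s) : Prop :=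
  match d with Ax _ | BotAx _ => True | _ => False end.

Definition introduces_succedent {s} (d : proof s) : Prop :=
  match d with
  | Ax _ | BotAx _ | AndR _ _ _ _ _ | OrR1 _ _ _ _ | OrR2 _ _ _ _
  | ImpR _ _ _ _ => True
  | _ => False
  end.

(* The antecedent occurrence at position [n] (counted from 0) of the end-sequent
   is newly introduced by the last inference. *)
Definition introduces_antecedent (n : nat) {s} (d : proof s) : Prop :=
  match d with
  | Ax _ | BotAx _ => n = 0
  | RuleK Θ _ _ _ _ | AndL1 Θ _ _ _ _ _ | AndL2 Θ _ _ _ _ _
  | OrL Θ _ _ _ _ _ _ => n = length Θ
  | ImpL Δ _ _ Θ _ _ _ _ => n = length (Θ ++ Δ)
  | _ => False
  end.

Definition rank_2 {Δ A} Θ {Γ C}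
    (e : proof (Δ ⊢ A)) (f : proof (Θ ++ A :: Γ ⊢ C)) : Prop :=
  introduces_succedent e /\ introduces_antecedent (length Θ) f.

Definition maximal_cut {Δ A} Θ {Γ C}
    (e : proof (Δ ⊢ A)) (f : proof (Θ ++ A :: Γ ⊢ C)) : Prop :=
  rank_2 Θ e f /\ ~ is_axiom e /\ ~ is_axiom f.

Fixpoint maximalized {s} (d : proof s) : Prop :=
  match d with
  | Ax _ | BotAx _ => True
  | RuleC _ _ _ _ _ e | RuleW _ _ _ _ e | RuleK _ _ _ _ e
  | AndL1 _ _ _ _ _ e | AndL2 _ _ _ _ _ e
  | OrR1 _ _ _ e | OrR2 _ _ _ e | ImpR _ _ _ e => maximalized e
  | Cut _ _ Θ _ _ e f => maximal_cut Θ e f /\ maximalized e /\ maximalized f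
  | AndR _ _ _ e f | OrL _ _ _ _ _ e f | ImpL _ _ _ _ _ _ e f =>
      maximalized e /\ maximalized f
  end.

(* Main.v *)
(* In a W-normal proof the applications of (W) inside the proof only serve to
   contract A, ..., A to A just above (→R), so they can be absorbed into a
   generalized (→R) discharging several copies of A; what remains of (W) is a
   final segment of the proof.  Without (W) no rule has two occurrences of the
   same cut formula above it, so a cut can be permuted upwards by structural
   induction: first in the right premise, until its cut formula is introduced
   there, then in the left premise.  The maximal cuts met on the way stay
   maximal, because a permuted cut passes above the rules that introduce their
   cut formulae and leaves these rules last.  Cut formulae are never decomposed,
   so the degree does not increase. *)

Require Import Defs.
From Stdlib Require Import List PeanoNat Lia.
Import ListNotations.

(** * A calculus without contraction *)

Inductive ending : Type :=
| IntroR
| IntroL (n : nat)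
| OtherEnd.

(* [mder m l Γ C]: there is a maximalized proof of Γ ⊢ C of degree at most [m]
   in the calculus without (W) but with the generalized (→R).  The index [l]
   says what a last rule other than an axiom introduces, [IntroL] counting
   positions as [introduces_antecedent] does. *)
Inductive mder (m : nat) : ending -> list formula -> formula -> Prop :=
| m_ax A : mder m OtherEnd [A] A
| m_bot A : mder m OtherEnd [Bot] A
| m_exch l Δ A B Γ C :
    mder m l (Δ ++ A :: B :: Γ) C -> mder m OtherEnd (Δ ++ B :: A :: Γ) C
| m_weak l Θ A Γ C :
    mder m l (Θ ++ Γ) C -> mder m (IntroL (length Θ)) (Θ ++ A :: Γ) C
| m_cut Δ A Θ Γ C :
    connectives A <= m -> mder m IntroR Δ A ->
    mder m (IntroL (length Θ)) (Θ ++ A :: Γ) C ->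
    mder m OtherEnd (Θ ++ Δ ++ Γ) C
| m_andL1 l Θ A B Γ C :
    mder m l (Θ ++ A :: Γ) C ->
    mder m (IntroL (length Θ)) (Θ ++ And A B :: Γ) C
| m_andL2 l Θ A B Γ C :
    mder m l (Θ ++ B :: Γ) C ->
    mder m (IntroL (length Θ)) (Θ ++ And A B :: Γ) C
| m_andR l1 l2 Γ A B :
    mder m l1 Γ A -> mder m l2 Γ B -> mder m IntroR Γ (And A B)
| m_orL l1 l2 Θ A B Γ C :
    mder m l1 (Θ ++ A :: Γ) C -> mder m l2 (Θ ++ B :: Γ) C ->
    mder m (IntroL (length Θ)) (Θ ++ Or A B :: Γ) C
| m_orR1 l Γ A B : mder m l Γ A -> mder m IntroR Γ (Or A B)
| m_orR2 l Γ A B : mder m l Γ B -> mder m IntroR Γ (Or A B)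
| m_impL l1 l2 Δ A B Θ Γ C :
    mder m l1 Δ A -> mder m l2 (Θ ++ B :: Γ) C ->
    mder m (IntroL (length (Θ ++ Δ))) (Θ ++ Δ ++ Imp A B :: Γ) C
| m_impR l k A Γ B :
    mder m l (repeat A (S k) ++ Γ) B -> mder m IntroR Γ (Imp A B).

(** * Rewriting contexts and locating an occurrence in them *)

Lemma mder_eq m l l' Γ Γ' C :
  mder m l Γ C -> l = l' -> Γ = Γ' -> mder m l' Γ' C.
Proof. now intros H <- <-. Qed.

Ltac list_norm := repeat first [rewrite <- !app_assoc | progress simpl].
Ltac len := f_equal; rewrite ?length_app; simpl; rewrite ?length_app; simpl; lia.
Ltac shape H := eapply mder_eq; [eapply H | try reflexivity; try len
                                | list_norm; reflexivity].

(** Together with the next lemma, decides in which part of a rule's conclusion the cut formula lies,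
    and so into which premise the cut is permuted. *)
Lemma app_eq_app_cons {T} (X Y Θ Γ : list T) a :
  X ++ Y = Θ ++ a :: Γ ->
  (exists M, X = Θ ++ a :: M /\ Γ = M ++ Y) \/
  (exists M, Θ = X ++ M /\ Y = M ++ a :: Γ).
Proof.
  intros H. apply app_eq_app in H as [M [[-> H]|[-> ->]]]; [|eauto].
  destruct M as [|b M]; simpl in H.
  - right. exists []. now rewrite !app_nil_r.
  - injection H as <- ->. left. eauto.
Qed.

Lemma app_cons_eq_app_cons {T} (X Y Θ Γ : list T) b a :
  X ++ b :: Y = Θ ++ a :: Γ ->
  (exists M, X = Θ ++ a :: M /\ Γ = M ++ b :: Y) \/
  (X = Θ /\ b = a /\ Y = Γ) \/
  (exists M, Θ = X ++ b :: M /\ Y = M ++ a :: Γ).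
Proof.
  intros H. apply app_eq_app_cons in H as [H|[[|c M] [-> H]]]; [auto| |].
  - injection H as -> ->. rewrite app_nil_r. auto.
  - injection H as <- ->. eauto.
Qed.

(** * Permuting cuts upwards, preceded by the structural moves this needs *)

Lemma mder_bot m Θ Γ C : exists l, mder m l (Θ ++ Bot :: Γ) C.
Proof.
  induction Θ as [|X Θ [l IH]]; simpl.
  - induction Γ as [|X Γ [l IH]]; [eauto using m_bot|].
    eexists. apply (m_weak _ l [Bot] X Γ). exact IH.
  - eexists. apply (m_weak _ l [] X). exact IH.
Qed.

(** Needed when an exchange moves the cut formula: once a cut has replaced that formula by [Δ], the
    other formula must cross all of [Δ], one exchange at a time. *)
Lemma mder_exch_block m l Θ A Δ Γ C :
  mder m l (Θ ++ A :: Δ ++ Γ) C -> exists l', mder m l' (Θ ++ Δ ++ A :: Γ) C.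
Proof.
  revert l Θ; induction Δ as [|B Δ IH]; intros l Θ H; [eauto|].
  apply m_exch in H.
  destruct (IH OtherEnd (Θ ++ [B])) as [l' H'].
  - shape H.
  - exists l'. shape H'.
Qed.

Lemma mder_exch_block_rev m l Θ A Δ Γ C :
  mder m l (Θ ++ Δ ++ A :: Γ) C -> exists l', mder m l' (Θ ++ A :: Δ ++ Γ) C.
Proof.
  revert l Γ; induction Δ as [|B Δ IH] using rev_ind; intros l Γ H; [eauto|].
  destruct (IH OtherEnd (B :: Γ)) as [l' H'].
  - eapply mder_eq; [eapply (m_exch _ _ (Θ ++ Δ))| |].
    + shape H.
    + reflexivity.
    + list_norm; reflexivity.
  - exists l'. shape H'.
Qed.

(* The first hypothesis on Θ, A, Γ ⊢ C is the case where the cut need not be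
   permuted any further. *)
Lemma cut_left m lf A Θ Γ C :
  mder m lf (Θ ++ A :: Γ) C ->
  (forall Δ, mder m IntroR Δ A -> exists l, mder m l (Θ ++ Δ ++ Γ) C) ->
  forall le Δ, mder m le Δ A ->
  exists l, mder m l (Θ ++ Δ ++ Γ) C /\
    (forall n, le = IntroL n -> l = IntroL (length Θ + n)).
Proof.
  intros f base le Δ e; revert f base.
  (* After a right rule the cut formula is newly introduced on the left, so the permutation
     stops. *)
  assert (stop : forall Δ A,
    (forall Δ, mder m IntroR Δ A -> exists l, mder m l (Θ ++ Δ ++ Γ) C) ->
    mder m IntroR Δ A ->
    exists l, mder m l (Θ ++ Δ ++ Γ) C /\
      (forall n, IntroR = IntroL n -> l = IntroL (length Θ + n))).
  { intros Δ' A' b H. destruct (b _ H) as [l Hl]. exists l; split; easy. }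
  induction e; intros f base.
  - exists lf. split; [exact f | easy].
  - destruct (mder_bot m Θ Γ C) as [l Hl]. exists l. split; [exact Hl | easy].
  - destruct (IHe f base) as [l' [Hc _]].
    exists OtherEnd; split; [|easy].
    eapply mder_eq; [eapply (m_exch _ _ (Θ ++ Δ) A B (Γ0 ++ Γ)) | |];
      [shape Hc | reflexivity | list_norm; reflexivity].
  - destruct (IHe f base) as [l' [Hc _]].
    eexists; split;
      [|intros n E; injection E as <-; rewrite <- length_app; reflexivity].
    eapply mder_eq; [eapply (m_weak _ _ (Θ ++ Θ0) A (Γ0 ++ Γ)) | |];
      [shape Hc | reflexivity | list_norm; reflexivity].
  (* The inner cut stays maximal: its formula is still introduced in the right premise, at a
     position shifted by [Θ]. *)
  - destruct (IHe2 f base) as [l' [Hc Hl]].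
    exists OtherEnd; split; [|easy]. rewrite (Hl _ eq_refl) in Hc.
    eapply mder_eq; [eapply (m_cut _ Δ A (Θ ++ Θ0) (Γ0 ++ Γ)) | |];
      [assumption | assumption | shape Hc | reflexivity | list_norm; reflexivity].
  - destruct (IHe f base) as [l' [Hc _]].
    eexists; split;
      [|intros n E; injection E as <-; rewrite <- length_app; reflexivity].
    eapply mder_eq; [eapply (m_andL1 _ _ (Θ ++ Θ0) A B (Γ0 ++ Γ)) | |];
      [shape Hc | reflexivity | list_norm; reflexivity].
  - destruct (IHe f base) as [l' [Hc _]].
    eexists; split;
      [|intros n E; injection E as <-; rewrite <- length_app; reflexivity].
    eapply mder_eq; [eapply (m_andL2 _ _ (Θ ++ Θ0) A B (Γ0 ++ Γ)) | |];
      [shape Hc | reflexivity | list_norm; reflexivity].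
  - eauto using m_andR.
  - destruct (IHe1 f base) as [l1' [H1 _]], (IHe2 f base) as [l2' [H2 _]].
    eexists; split;
      [|intros n E; injection E as <-; rewrite <- length_app; reflexivity].
    eapply mder_eq; [eapply (m_orL _ _ _ (Θ ++ Θ0) A B (Γ0 ++ Γ)) | |];
      [shape H1 | shape H2 | reflexivity | list_norm; reflexivity].
  - eauto using m_orR1.
  - eauto using m_orR2.
  - destruct (IHe2 f base) as [l' [Hc _]].
    eexists; split;
      [|intros n E; injection E as <-; rewrite <- length_app; reflexivity].
    eapply mder_eq; [eapply (m_impL _ _ _ Δ A B (Θ ++ Θ0) (Γ0 ++ Γ)) | |];
      [eassumption | shape Hc | len | list_norm; reflexivity].
  - eauto using m_impR.
Qed.

Lemma mder_IntroR_Bot m Δ : ~ mder m IntroR Δ Bot.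
Proof. inversion 1. Qed.

(* [l'] marks in Θ, Δ, Γ the occurrence that [l] marks in Θ, A, Γ, where [p]
   and [q] are the lengths of Θ and Δ; nothing is required if it marks A. *)
Definition same_ending (p q : nat) (l l' : ending) : Prop :=
  match l with
  | IntroR => l' = IntroR
  | IntroL n => (n < p -> l' = IntroL n) /\
                (forall j, n = p + S j -> l' = IntroL (p + q + j))
  | OtherEnd => True
  end.

(** Induction on the right premise. The ending is tracked because the cut may enter a premise of a
    maximal cut, which must stay maximal. Once the last rule introduces the cut formula, the
    permutation goes on in the left premise. *)
Lemma cut_right m le Δ A :
  connectives A <= m -> mder m le Δ A ->
  forall l S C, mder m l S C -> forall Θ Γ, S = Θ ++ A :: Γ ->
  exists l', mder m l' (Θ ++ Δ ++ Γ) C /\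
    same_ending (length Θ) (length Δ) l l'.
Proof.
  intros hA e.
  assert (principal : forall Θ Γ C,
    mder m (IntroL (length Θ)) (Θ ++ A :: Γ) C ->
    exists l', mder m l' (Θ ++ Δ ++ Γ) C /\
      same_ending (length Θ) (length Δ) (IntroL (length Θ)) l').
  { intros Θ Γ C H.
    destruct (cut_left m _ A Θ Γ C H) with (2 := e) as [l [Hl _]].
    (* Both premises introduce the cut formula here, so the cut is maximal and is kept. *)
    - intros Δ' H'. exists OtherEnd. eapply m_cut; eassumption.
    - exists l. split; [exact Hl | split; intros; lia]. }
  assert (ending_before : forall Θ M,
    same_ending (length Θ) (length Δ) (IntroL (length (Θ ++ A :: M)))
      (IntroL (length (Θ ++ Δ ++ M)))).
  { intros Θ M. split; rewrite !length_app; simpl; intros; [lia | len]. }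
  assert (ending_after : forall Θ (X : formula) M,
    same_ending (length (Θ ++ X :: M)) (length Δ) (IntroL (length Θ))
      (IntroL (length Θ))).
  { intros Θ X M. split; rewrite !length_app; simpl; intros; [easy | lia]. }
  induction 1; intros Θ1 Γ1 E.
  - destruct Θ1 as [|? [|]]; try discriminate. injection E as <- <-. simpl.
    rewrite app_nil_r. exists le; simpl; auto.
  - destruct Θ1 as [|? [|]]; try discriminate. injection E as <- <-.
    destruct (cut_left m OtherEnd Bot [] [] A0) with (3 := e) as [l [Hl _]].
    + apply m_bot.
    (* No right rule introduces [Bot], so no cut ever has to be kept. *)
    + intros Δ' H. now apply mder_IntroR_Bot in H.
    + exists l. simpl; auto.
  - apply app_cons_eq_app_cons in E as [[M [-> ->]]|[[-> [-> <-]]|[[|X M] [-> E]]]].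
    + destruct (IHmder Θ1 (M ++ A0 :: B :: Γ)) as [l' [H' _]]; [list_norm; reflexivity|].
      exists OtherEnd; split; [|exact I].
      eapply mder_eq; [eapply (m_exch _ _ (Θ1 ++ Δ ++ M)) | |];
        [shape H' | reflexivity | list_norm; reflexivity].
    + destruct (IHmder (Θ1 ++ [A0]) Γ) as [l' [H' _]]; [list_norm; reflexivity|].
      rewrite <- app_assoc in H'. apply (mder_exch_block _ _ Θ1 A0 Δ Γ) in H' as [l'' H''].
      exists l''; split; [exact H'' | exact I].
    + injection E as -> ->.
      destruct (IHmder Δ0 (B :: Γ1)) as [l' [H' _]]; [list_norm; reflexivity|].
      apply mder_exch_block_rev in H' as [l'' H''].
      exists l''; split; [shape H'' | exact I].
    + injection E as <- ->.
      destruct (IHmder (Δ0 ++ A0 :: B :: M) Γ1) as [l' [H' _]]; [list_norm; reflexivity|].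
      exists OtherEnd; split; [|exact I].
      eapply mder_eq; [eapply (m_exch _ _ Δ0 A0 B (M ++ Δ ++ Γ1)) | |];
        [shape H' | reflexivity | list_norm; reflexivity].
  - apply app_cons_eq_app_cons in E as [[M [-> ->]]|[[-> [-> <-]]|[M [-> ->]]]].
    + destruct (IHmder Θ1 (M ++ Γ)) as [l' [H' _]]; [list_norm; reflexivity|].
      eexists; split; [|apply ending_before].
      eapply mder_eq; [eapply (m_weak _ _ (Θ1 ++ Δ ++ M)) | |];
        [shape H' | reflexivity | list_norm; reflexivity].
    + apply principal. eapply m_weak; eassumption.
    + destruct (IHmder (Θ ++ M) Γ1) as [l' [H' _]]; [list_norm; reflexivity|].
      eexists; split; [|apply ending_after].
      eapply mder_eq; [eapply (m_weak _ _ Θ A0 (M ++ Δ ++ Γ1)) | |];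
        [shape H' | reflexivity | list_norm; reflexivity].
  - apply app_eq_app_cons in E as [[M [-> ->]]|[M' [-> E]]];
      [|apply app_eq_app_cons in E as [[M [-> ->]]|[M [-> ->]]]].
    + destruct (IHmder2 Θ1 (M ++ A0 :: Γ)) as [l' [H' [_ Hl]]]; [list_norm; reflexivity|].
      (* Exactly [M] separates the replaced [A] from the inner cut formula [A0], which fixes the new
         position of [A0]. *)
      rewrite (Hl (length M)) in H' by (rewrite length_app; reflexivity).
      exists OtherEnd; split; [|exact I].
      eapply mder_eq; [eapply (m_cut _ Δ0 A0 (Θ1 ++ Δ ++ M) Γ) | |];
        [assumption | assumption | shape H' | reflexivity | list_norm; reflexivity].
    (* Cutting into the left premise leaves the right rule that introduces [A0] last. *)
    + destruct (IHmder1 M' M) as [l' [H' Hl]]; [reflexivity|].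
      simpl in Hl; subst l'.
      exists OtherEnd; split; [|exact I].
      eapply mder_eq; [eapply (m_cut _ (M' ++ Δ ++ M) A0 Θ Γ) | |];
        [assumption | shape H' | assumption | reflexivity | list_norm; reflexivity].
    + destruct (IHmder2 (Θ ++ A0 :: M) Γ1) as [l' [H' [Hl _]]]; [list_norm; reflexivity|].
      rewrite Hl in H' by (rewrite length_app; simpl; lia).
      exists OtherEnd; split; [|exact I].
      eapply mder_eq; [eapply (m_cut _ Δ0 A0 Θ (M ++ Δ ++ Γ1)) | |];
        [assumption | assumption | shape H' | reflexivity | list_norm; reflexivity].
  - apply app_cons_eq_app_cons in E as [[M [-> ->]]|[[-> [<- <-]]|[M [-> ->]]]].
    + destruct (IHmder Θ1 (M ++ A0 :: Γ)) as [l' [H' _]]; [list_norm; reflexivity|].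
      eexists; split; [|apply ending_before].
      eapply mder_eq; [eapply (m_andL1 _ _ (Θ1 ++ Δ ++ M)) | |];
        [shape H' | reflexivity | list_norm; reflexivity].
    + apply principal. eapply m_andL1; eassumption.
    + destruct (IHmder (Θ ++ A0 :: M) Γ1) as [l' [H' _]]; [list_norm; reflexivity|].
      eexists; split; [|apply ending_after].
      eapply mder_eq; [eapply (m_andL1 _ _ Θ A0 B (M ++ Δ ++ Γ1)) | |];
        [shape H' | reflexivity | list_norm; reflexivity].
  - apply app_cons_eq_app_cons in E as [[M [-> ->]]|[[-> [<- <-]]|[M [-> ->]]]].
    + destruct (IHmder Θ1 (M ++ B :: Γ)) as [l' [H' _]]; [list_norm; reflexivity|].
      eexists; split; [|apply ending_before].
      eapply mder_eq; [eapply (m_andL2 _ _ (Θ1 ++ Δ ++ M)) | |];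
        [shape H' | reflexivity | list_norm; reflexivity].
    + apply principal. eapply m_andL2; eassumption.
    + destruct (IHmder (Θ ++ B :: M) Γ1) as [l' [H' _]]; [list_norm; reflexivity|].
      eexists; split; [|apply ending_after].
      eapply mder_eq; [eapply (m_andL2 _ _ Θ A0 B (M ++ Δ ++ Γ1)) | |];
        [shape H' | reflexivity | list_norm; reflexivity].
  - destruct (IHmder1 Θ1 Γ1 E) as [? [H1 _]], (IHmder2 Θ1 Γ1 E) as [? [H2 _]].
    exists IntroR. split; [eapply m_andR; eassumption | reflexivity].
  - apply app_cons_eq_app_cons in E as [[M [-> ->]]|[[-> [<- <-]]|[M [-> ->]]]].
    + destruct (IHmder1 Θ1 (M ++ A0 :: Γ)) as [l' [H1 _]]; [list_norm; reflexivity|].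
      destruct (IHmder2 Θ1 (M ++ B :: Γ)) as [l'' [H2 _]]; [list_norm; reflexivity|].
      eexists; split; [|apply ending_before].
      eapply mder_eq; [eapply (m_orL _ _ _ (Θ1 ++ Δ ++ M)) | |];
        [shape H1 | shape H2 | reflexivity | list_norm; reflexivity].
    + apply principal. eapply m_orL; eassumption.
    + destruct (IHmder1 (Θ ++ A0 :: M) Γ1) as [l' [H1 _]]; [list_norm; reflexivity|].
      destruct (IHmder2 (Θ ++ B :: M) Γ1) as [l'' [H2 _]]; [list_norm; reflexivity|].
      eexists; split; [|apply ending_after].
      eapply mder_eq; [eapply (m_orL _ _ _ Θ A0 B (M ++ Δ ++ Γ1)) | |];
        [shape H1 | shape H2 | reflexivity | list_norm; reflexivity].
  - destruct (IHmder Θ1 Γ1 E) as [? [H1 _]].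
    exists IntroR. split; [eapply m_orR1; eassumption | reflexivity].
  - destruct (IHmder Θ1 Γ1 E) as [? [H1 _]].
    exists IntroR. split; [eapply m_orR2; eassumption | reflexivity].
  - apply app_eq_app_cons in E as [[M [-> ->]]|[M' [-> E]]];
      [|apply app_cons_eq_app_cons in E as [[M [-> ->]]|[[-> [<- <-]]|[M [-> ->]]]]].
    + destruct (IHmder2 Θ1 (M ++ B :: Γ)) as [l' [H' _]]; [list_norm; reflexivity|].
      exists (IntroL (length ((Θ1 ++ Δ ++ M) ++ Δ0))); split.
      * eapply mder_eq; [eapply (m_impL _ _ _ Δ0 A0 B (Θ1 ++ Δ ++ M) Γ) | |];
          [eassumption | shape H' | reflexivity | list_norm; reflexivity].
      * list_norm. apply ending_before.
    + destruct (IHmder1 M' M) as [l' [H' _]]; [reflexivity|].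
      exists (IntroL (length ((Θ ++ M') ++ Δ ++ M))); split.
      * eapply mder_eq; [eapply (m_impL _ _ _ (M' ++ Δ ++ M) A0 B Θ Γ) | |];
          [shape H' | eassumption | len | list_norm; reflexivity].
      * rewrite app_assoc. apply ending_before.
    + apply principal. rewrite <- app_assoc.
      eapply m_impL; eassumption.
    + destruct (IHmder2 (Θ ++ B :: M) Γ1) as [l' [H' _]]; [list_norm; reflexivity|].
      rewrite (app_assoc Θ). eexists; split; [|apply ending_after].
      eapply mder_eq; [eapply (m_impL _ _ _ Δ0 A0 B Θ (M ++ Δ ++ Γ1)) | |];
        [eassumption | shape H' | reflexivity | list_norm; reflexivity].
  - destruct (IHmder (repeat A0 (S k) ++ Θ1) Γ1) as [? [H1 _]];
      [rewrite E; list_norm; reflexivity|].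
    exists IntroR. split; [|reflexivity].
    rewrite <- app_assoc in H1. eapply m_impR; eassumption.
Qed.

(** * From W-normal proofs to the calculus without contraction *)

(** [W_normal] is the case of empty [below]; unlike it, this form passes to subproofs. *)
Definition normal_over (below : list inference) {s} (d : proof s) : Prop :=
  forall u b, In (u, b) (occurrences below d) -> is_W u ->
    Forall is_W b \/ exists l b', b = l :: b' /\ W_context u l.

Lemma normal_over_last below s (d : proof s) i :
  normal_over (i :: below) d -> is_W (last_inference d) ->
  ~ Forall is_W (i :: below) -> W_context (last_inference d) i.
Proof.
  intros H HW Hb.
  destruct (H (last_inference d) (i :: below)) as [H'|[l [b' [E H']]]];
    [destruct d; simpl; auto | assumption | easy |].
  now injection E as <- <-.
Qed.

(** The lower rule of both contexts is (W) or (→R). *)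
Lemma normal_over_InfOther below s (d : proof s) :
  normal_over (InfOther :: below) d -> ~ is_W (last_inference d).
Proof.
  intros H HW. apply normal_over_last in H; [|assumption|].
  - inversion H.
  - intros F. now inversion F.
Qed.

Lemma repeat_app_cons {T} (a : T) k k' Γ :
  repeat a k ++ a :: repeat a k' ++ Γ = repeat a (S (k + k')) ++ Γ.
Proof.
  change (repeat a k ++ repeat a (S k') ++ Γ = repeat a (S (k + k')) ++ Γ).
  now rewrite app_assoc, <- repeat_app, Nat.add_succ_r.
Qed.

Lemma mder_of_proof m s (d : proof s) below :
  degree d <= m -> normal_over below d ->
  (~ is_W (last_inference d) ->
   exists l, mder m l (antecedent s) (succedent s)) /\
  (~ Forall is_W below -> forall A k k' Γ C,
   last_inference d = InfW (repeat A k) A (repeat A k' ++ Γ) C ->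
   exists j l, mder m l (repeat A (S j) ++ Γ) C).
Proof.
  revert below.
  assert (nW : forall i below, ~ is_W i -> ~ Forall is_W (i :: below)).
  { intros i below H F. now inversion F. }
  induction d; intros below hm hn; simpl in hm;
  (* A premise of a rule other than (W) and (→R) does not end in (W), so the first claim applies to
     it. *)
  try (assert (hn0 : normal_over (InfOther :: below) d)
         by (intros u b Hin; apply hn; right; exact Hin);
       destruct (IHd _ hm hn0) as [IH _];
       destruct (IH (normal_over_InfOther _ _ _ hn0)) as [l Hl]; simpl in Hl);
  try (assert (hn1 : normal_over (InfOther :: below) d1)
         by (intros u b Hin; apply hn; right; apply in_or_app; auto);
       assert (hn2 : normal_over (InfOther :: below) d2)
         by (intros u b Hin; apply hn; right; apply in_or_app; auto);
       destruct (IHd1 (InfOther :: below)) as [IH1 _]; [lia | exact hn1 |];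
       destruct (IHd2 (InfOther :: below)) as [IH2 _]; [lia | exact hn2 |];
       destruct (IH1 (normal_over_InfOther _ _ _ hn1)) as [l1 Hl1];
       destruct (IH2 (normal_over_InfOther _ _ _ hn2)) as [l2 Hl2];
       simpl in Hl1, Hl2);
  (split; [intros HW; simpl in *|]);
  try (intros; simpl in *; discriminate).
  - eauto using m_ax.
  - eauto using m_bot.
  - eauto using m_exch.
  - now exfalso.
  - intros Hb A0 k k' Γ0 C0 E. injection E as -> <- -> <-.
    assert (hn0 : normal_over (InfW (repeat A k) A (repeat A k' ++ Γ0) C :: below) d)
      by (intros u b Hin; apply hn; right; exact Hin).
    assert (Hb' : ~ Forall is_W (InfW (repeat A k) A (repeat A k' ++ Γ0) C :: below))
      by (intros F; inversion F; auto).
    destruct (IHd _ hm hn0) as [IH IHW]. specialize (IHW Hb').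
    pose proof (fun H => normal_over_last _ _ _ _ hn0 H Hb') as ctx.
    destruct (last_inference d) eqn:EL.
    (* By context (i) the next (W) above contracts the first two or the last two of three copies, so
       the block grows on the right or on the left. *)
    + specialize (ctx I). inversion ctx; subst.
      * apply (IHW A k (S k') Γ0 C). reflexivity.
      * apply (IHW A (S k) k' Γ0 C). now rewrite <- (repeat_cons k A).
    (* The run starts here: [k] copies, the contracted pair and [k'] copies make [S (k + S k')]. *)
    + destruct IH as [l Hl]; [easy|]. simpl in Hl.
      exists (k + S k'), l. now rewrite <- repeat_app_cons.
    + destruct IH as [l Hl]; [easy|]. simpl in Hl.
      exists (k + S k'), l. now rewrite <- repeat_app_cons.
  - eauto using m_weak.
  - assert (hA : connectives A <= m) by lia.
    destruct (cut_right m _ _ _ hA Hl1 _ _ _ Hl2 _ _ eq_refl)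
      as [l [H _]]. eauto.
  - eauto using m_andL1.
  - eauto using m_andL2.
  - eauto using m_andR.
  - eauto using m_orL.
  - eauto using m_orR1.
  - eauto using m_orR2.
  - eauto using m_impL.
  - assert (hn0 : normal_over (InfImpR A Γ B :: below) d)
      by (intros u b Hin; apply hn; right; exact Hin).
    assert (Hb' : ~ Forall is_W (InfImpR A Γ B :: below)) by auto.
    destruct (IHd _ hm hn0) as [IH IHW]. specialize (IHW Hb').
    pose proof (fun H => normal_over_last _ _ _ _ hn0 H Hb') as ctx.
    exists IntroR.
    destruct (last_inference d) eqn:EL.
    + specialize (ctx I). inversion ctx; subst.
      (* Context (ii) puts the contracted formula in front, and all of [Γ] is kept, so both counts
         begin at 0. *)
      destruct (IHW A 0 0 Γ B eq_refl) as [j [l Hl]].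
      exact (m_impR _ _ _ _ _ _ Hl).
    + destruct IH as [l Hl]; [easy|]. exact (m_impR _ _ 0 _ _ _ Hl).
    + destruct IH as [l Hl]; [easy|]. exact (m_impR _ _ 0 _ _ _ Hl).
Qed.

(** * Back to W-normal proofs in the original system *)

(** Axioms also introduce formulae, but may not be premises of a maximal cut; hence the second
    conjuncts. *)
Definition has_ending (l : ending) {s} (d : proof s) : Prop :=
  match l with
  | IntroR => introduces_succedent d /\ ~ is_axiom d
  | IntroL n => introduces_antecedent n d /\ ~ is_axiom d
  | OtherEnd => True
  end.

(** Normality over every [below] lets such a proof be a premise of any rule. *)
Definition good (m : nat) {s} (d : proof s) : Prop :=
  (forall below, normal_over below d) /\ maximalized d /\ degree d <= m.

(** The first two copies are contracted repeatedly. Each (W) is in context (i) with the next one;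
    the lowest is in a context with [i], which is (W) within the induction and (→R) in the
    application. *)
Lemma contract_above_ImpR m k A Γ B :
  (exists d : proof (repeat A (S k) ++ Γ ⊢ B), good m d) ->
  exists d : proof (A :: Γ ⊢ B),
    (forall i below, W_context (InfW [] A Γ B) i -> normal_over (i :: below) d) /\
    maximalized d /\ degree d <= m.
Proof.
  revert Γ; induction k as [|k IH]; intros Γ H.
  - destruct H as [d [Hn Hd]]. exists d. auto.
  - destruct (IH (A :: Γ)) as [d [Hn [Hm Hd]]].
    { replace (repeat A (S k) ++ A :: Γ) with (repeat A (S (S k)) ++ Γ);
        [exact H|].
      symmetry. etransitivity; [apply (repeat_app_cons A (S k) 0)|].
      now rewrite Nat.add_0_r. }
    exists (RuleW [] A Γ B d). split; [|auto].
    intros i below Hi u b [E|Hin] HW.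
    + injection E as <- <-. eauto.
    + eapply Hn; [|exact Hin|exact HW]. apply (W_context_i_first []).
Qed.

(** Each rule is read back as itself, except that the generalized (→R) becomes contractions followed
    by (→R). The endings of its premises make each cut maximal. *)
Lemma proof_of_mder m l Γ C :
  mder m l Γ C -> exists d : proof (Γ ⊢ C), good m d /\ has_ending l d.
Proof.
  assert (inherit1 : forall s1 (d1 : proof s1) s (d : proof s),
    (forall below, normal_over below d1) ->
    (forall below, occurrences below d =
       (InfOther, below) :: occurrences (InfOther :: below) d1) ->
    forall below, normal_over below d).
  { intros s1 d1 s d Hn Ho below u b Hin HW. rewrite Ho in Hin.
    destruct Hin as [E|Hin]; [now injection E as <- <-|].
    eapply Hn; eassumption. }
  assert (inherit2 : forall s1 (d1 : proof s1) s2 (d2 : proof s2) s (d : proof s),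
    (forall below, normal_over below d1) -> (forall below, normal_over below d2) ->
    (forall below, occurrences below d = (InfOther, below) ::
       occurrences (InfOther :: below) d1 ++ occurrences (InfOther :: below) d2) ->
    forall below, normal_over below d).
  { intros s1 d1 s2 d2 s d Hn1 Hn2 Ho below u b Hin HW. rewrite Ho in Hin.
    destruct Hin as [E|Hin]; [now injection E as <- <-|].
    apply in_app_or in Hin as [Hin|Hin]; [eapply Hn1 | eapply Hn2]; eassumption. }
  induction 1;
  try (destruct IHmder as [d [[Hn [Hm Hd]] He]]);
  try (destruct IHmder1 as [d1 [[Hn1 [Hm1 Hd1]] He1]];
       destruct IHmder2 as [d2 [[Hn2 [Hm2 Hd2]] He2]]).
  - exists (Ax A). repeat split; simpl; try lia.
    intros below u b [E|[]] HW. injection E as <- <-. easy.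
  - exists (BotAx A). repeat split; simpl; try lia.
    intros below u b [E|[]] HW. injection E as <- <-. easy.
  - exists (RuleC _ _ _ _ _ d). repeat split; simpl; auto.
    now apply (inherit1 _ d).
  - exists (RuleK _ A _ _ d). repeat split; simpl; auto.
    now apply (inherit1 _ d).
  - exists (Cut _ _ _ _ _ d1 d2). repeat split; simpl; try tauto; try lia.
    now apply (inherit2 _ d1 _ d2).
    all: simpl in *; tauto.
  - exists (AndL1 _ _ _ _ _ d). repeat split; simpl; auto.
    now apply (inherit1 _ d).
  - exists (AndL2 _ _ _ _ _ d). repeat split; simpl; auto.
    now apply (inherit1 _ d).
  - exists (AndR _ _ _ d1 d2). repeat split; simpl; auto; try lia.
    now apply (inherit2 _ d1 _ d2).
  - exists (OrL _ _ _ _ _ d1 d2). repeat split; simpl; auto; try lia.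
    now apply (inherit2 _ d1 _ d2).
  - exists (OrR1 _ _ _ d). repeat split; simpl; auto.
    now apply (inherit1 _ d).
  - exists (OrR2 _ _ _ d). repeat split; simpl; auto.
    now apply (inherit1 _ d).
  - exists (ImpL _ _ _ _ _ _ d1 d2). repeat split; simpl; auto; try lia.
    now apply (inherit2 _ d1 _ d2).
  - destruct (contract_above_ImpR m k A Γ B) as [d' [Hn' [Hm' Hd']]].
    { exists d. repeat split; assumption. }
    exists (ImpR _ _ _ d'). repeat split; simpl; auto.
    intros below u b [E|Hin] HW; [now injection E as <- <-|].
    eapply Hn'; [|exact Hin|exact HW]. constructor.
Qed.

(** * The final segment of contractions *)

(** The final contractions are kept; only the subproof above them passes through the calculus
    without (W), with its own degree as the bound. *)
Lemma maximalize_final_contractions s (d : proof s) below :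
  Forall is_W below -> normal_over below d ->
  exists d' : proof s,
    (forall below, Forall is_W below -> normal_over below d') /\
    maximalized d' /\ degree d' <= degree d.
Proof.
  revert below. induction d; intros below Hb hn;
  match goal with
  | |- exists _, _ /\ _ /\ _ <= degree (RuleW _ _ _ _ _) => idtac
  | |- exists _, _ /\ _ /\ _ <= degree ?d =>
      destruct (mder_of_proof _ _ d below (Nat.le_refl _) hn) as [H _];
      (* The last rule is not (W), so [is_W] reduces to [False] and the identity proves its
         negation. *)
      destruct (H (fun x => x)) as [l Hl];
      destruct (proof_of_mder _ _ _ _ Hl) as [d' [[Hn Hd] _]];
      exists d'; split; [intros; apply Hn | exact Hd]
  end.
  destruct (IHd (InfW Θ A Γ C :: below)) as [d' [Hn [Hm Hd]]].
  - now constructor.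
  - intros u b Hin. apply hn. right. exact Hin.
  - exists (RuleW _ _ _ _ d'). split; [|auto].
    intros below' Hb' u b [E|Hin] HW.
    + injection E as <- <-. auto.
    + eapply Hn; [|exact Hin|exact HW]. now constructor.
Qed.

Theorem theorem6p1 (s : sequent) (d : proof s) (hd : W_normal d) :
  exists d' : proof s, W_normal d' /\ maximalized d' /\ degree d' <= degree d.
Proof.
  destruct (maximalize_final_contractions s d [] (Forall_nil _) hd)
    as [d' [Hn Hd]].
  exists d'. split; [apply Hn; constructor | exact Hd].
Qed.
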